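(* For fixed irrational $q\in(0,1)$, consider the metric Polish probability space $\mathfrak{X}:=[-1,-(1-q)]\cup[0,1-q]$, equipped with its Euclidean metric $d$ and uniform probability $\mu$. Then $(\mathfrak{X},d,\mu)$ is not $(n,\epsilon,r)$-average-case approximable for any $n\in\mathbb{N}$, $0<r<1-q$, and $0<\epsilon<1$. In particular, $(\mathfrak{X},d,\mu)$ is not asymptotically average-case approximable for any rate.
   Context: $\mathbb{N}=\{1,2,\dots\}$. A metric Polish probability space $(\mathfrak{X},d,\mu)$ consists of a Polish space $\mathfrak{X}$, a (not necessarily complete) metric $d$ generating its topology, and a Borel probability measure $\mu$. $B(x,r)=\{y\in\mathfrak{X}: d(x,y)\leq r\}$ is the closed ball, and $\|f\|_{\mathrm{Lip},B(x,r)}$ is the local Lipschitz constant of $f$ over $B(x,r)$, i.e. the (smallest) Lipschitz constant of the restriction of $f$ to $B(x,r)$. Here the uniform probability is Lebesgue measure restricted to $\mathfrak{X}$ (which has total length $1$). Given $n\in\mathbb{N}$, $\epsilon>0$ and $r>0$, $(\mathfrak{X},d,\mu)$ is $(n,\epsilon,r)$-average-case approximable if, whenever $X_1,\dots,X_n$ are i.i.d. with distribution $\mu$ on a probability space $(\Psi,\mathcal{F},\mathbb{P})$, there is an event of $\mathbb{P}$-probability at least $1-\epsilon$ on which $$\bigg|\int f(x)\,\mu(dx)-\frac1n\sum_{i=1}^n f(X_i)\bigg|\leq r\cdot\frac1n\sum_{i=1}^n\|f\|_{\mathrm{Lip},B(X_i,r)}$$ for all Lipschitz functions $f:\mathfrak{X}\rightarrow\mathbb{R}$.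 Given $\epsilon,r:\mathbb{N}\rightarrow\mathbb{R}_{\geq0}$ which vanish as $n\rightarrow\infty$, $(\mathfrak{X},d,\mu)$ is asymptotically average-case approximable with rate $(\epsilon,r)$ if, for all $n$ sufficiently large, it is $(n,\epsilon(n),r(n))$-average-case approximable. *)

(* Defs.v *)
From HB Require Import structures.
From mathcomp Require Import all_boot all_order all_algebra.
From mathcomp Require Import all_classical all_reals all_analysis.
From mathcomp Require Import ring.

Set Implicit Arguments.
Unset Strict Implicit.
Unset Printing Implicit Defensive.

Import Order.TTheory GRing.Theory Num.Theory.
Import numFieldNormedType.Exports.

Local Open Scope classical_set_scope.
Local Open Scope ring_scope.

Definition separable (T : topologicalType) : Prop :=
  exists2 D : set T, countable D & dense D.

(* The metric [rho] witnessing complete metrizability may be different from a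
   metric that [T] already carries. *)
Definition completely_metrizable (R : realType) (T : topologicalType) : Prop :=
  exists rho : T -> T -> R,
    [/\ forall x y, rho x y = 0 <-> x = y,
        forall x y, rho x y = rho y x,
        forall x y z, rho x z <= rho x y + rho y z,
        forall x (A : set T),
          nbhs x A <-> exists2 e, 0 < e & [set y | rho x y < e] `<=` A
      & forall u : nat -> T,
          (forall e, 0 < e -> exists N, forall m n,
             (N <= m)%N -> (N <= n)%N -> rho (u m) (u n) < e) ->
          exists l : T, u @ \oo --> l].

HB.mixin Record isMetricPolish (R : realType) (d : measure_display) T
    & Metric R T & Measurable d T := {
  polish_separable : separable T ;
  polish_complete : completely_metrizable R T ;
  polish_borel : @measurable d T = <<s @open T >>
}.

#[short(type="metricPolishType")]
HB.structure Definition MetricPolish (R : realType) (d : measure_display) :=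
  {T of Metric R T & Measurable d T & isMetricPolish R d T}.

Section lipschitz.
Context (R : realType) (T : metricType R).

(* [closed_ball] is the closure of the open ball, which can be strictly
   smaller than the closed ball, already on a subset of the line. *)
Definition mclosed_ball (x : T) (r : R) : set T := [set y | mdist x y <= r].

Definition lipschitz_bound (A : set T) (f : T -> R) (L : R) : Prop :=
  0 <= L /\ forall y z, A y -> A z -> `|f y - f z| <= L * mdist y z.

Definition is_lipschitz (f : T -> R) : Prop :=
  exists L, lipschitz_bound setT f L.

Definition lipschitz_const (A : set T) (f : T -> R) : R :=
  inf [set L | lipschitz_bound A f L].

End lipschitz.

Section iid.
Context (R : realType) (d d' : measure_display).
Context (Psi : measurableType d) (T : measurableType d').
Context (P : probability Psi R) (n : nat).

Definition mutually_independent (X : 'I_n -> {RV P >-> T}) : Prop :=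
  forall (J : {set 'I_n}) (A : 'I_n -> set T),
    (forall i, i \in J -> measurable (A i)) ->
    P (\bigcap_(i in [set` J]) (X i @^-1` A i)) =
    (\prod_(i in J) P (X i @^-1` A i))%E.

Definition iid_with_law (mu : probability T R) (X : 'I_n -> {RV P >-> T}) :
    Prop :=
  mutually_independent X /\
  forall i (A : set T), measurable A -> distribution P (X i) A = mu A.

End iid.

Section average_case.
Context (R : realType) (d : measure_display) (T : metricPolishType R d).
Context (mu : probability T R).

(* The integral is extended-real valued, so that the inequality fails, rather
   than being about a default value, when [f] is not integrable. *)
Definition average_case_approximable (n : nat) (eps r : R) : Prop :=
  forall (d' : measure_display) (Psi : measurableType d')
         (P : probability Psi R) (X : 'I_n -> {RV P >-> T}),
    iid_with_law mu X ->
    exists E : set Psi,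
      [/\ measurable E,
          ((1 - eps)%:E <= P E)%E
        & forall w, E w -> forall f : T -> R, is_lipschitz f ->
            (`| \int[mu]_x (f x)%:E - ((\sum_(i < n) f (X i w)) / n%:R)%:E |
             <= (r * ((\sum_(i < n)
                   lipschitz_const (mclosed_ball (X i w) r) f) / n%:R))%:E)%E].

(* Sequences are indexed by n >= 1; the value at 0 is ignored. *)
Definition vanishing_rate (u : nat -> R) : Prop :=
  (forall n, (0 < n)%N -> 0 <= u n) /\ u @ \oo --> 0.

Definition asymptotically_average_case_approximable (eps r : nat -> R) : Prop :=
  \forall n \near \oo, average_case_approximable n (eps n) (r n).

End average_case.

Section two_intervals.
Context (R : realType).

Definition two_intervals_set (q : R) : set R :=
  `[-1, -(1 - q)]%classic `|` `[0, 1 - q]%classic.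

Definition two_intervals (q : R) : Type := set_type (two_intervals_set q).

Definition two_intervals_val (q : R) (x : two_intervals q) : R := val x.

Context (q : R).
Local Notation X := (two_intervals q).
Local Notation inc := (@two_intervals_val q).

HB.instance Definition _ := Choice.copy X (set_type (two_intervals_set q)).

Lemma two_intervals_valP (x : X) : two_intervals_set q (inc x).
Proof. by case: x => x xX; exact: set_mem xX. Qed.

Lemma two_intervals_val_inj : injective inc.
Proof. exact: val_inj. Qed.

Definition two_intervals_dist (x y : X) : R := `|inc x - inc y|.

Let distxx x : two_intervals_dist x x = 0.
Proof. by rewrite /two_intervals_dist subrr normr0. Qed.

Let dist_pos x y : two_intervals_dist x y = 0 -> x = y.
Proof. by move/normr0_eq0/subr0_eq/two_intervals_val_inj. Qed.

Let dist_sym x y : two_intervals_dist x y = two_intervals_dist y x.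
Proof. exact: distrC. Qed.

Let dist_triangle y x z :
  two_intervals_dist x z <= two_intervals_dist x y + two_intervals_dist y z.
Proof. exact: ler_distD. Qed.

HB.instance Definition _ :=
  @isMetric.Build R X two_intervals_dist distxx dist_pos dist_sym dist_triangle.

(* [measurableType] requires a default point; the set is nonempty for every
   [q], including those outside ]0, 1[. *)
Let two_intervals_nonempty : exists x, x \in two_intervals_set q.
Proof.
have [q0|q0] := leP 0 q.
- exists (-1); apply/mem_set; left => /=.
  by rewrite in_itv/= lexx lerN2 gerBl.
- exists 0; apply/mem_set; right => /=.
  by rewrite in_itv/= lexx subr_ge0 (le_trans (ltW q0)).
Qed.

HB.instance Definition _ := isPointed.Build X
  (SigSub (svalP (cid two_intervals_nonempty))).

Definition two_intervals_display : measure_display := sigma_display (@open X).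

HB.instance Definition _ := Measurable.copy X (g_sigma_algebraType (@open X)).

Let nbhs_dist (x : X) (A : set X) :
  nbhs x A <-> exists2 e, 0 < e & [set y | two_intervals_dist x y < e] `<=` A.
Proof.
split=> [/nbhs_ballP[e /= e0 xeA]|[e e0 xeA]].
- by exists e => // y /= xy; apply: xeA; rewrite ballEmdist.
- by apply/nbhs_ballP; exists e => //= y; rewrite ballEmdist => /xeA.
Qed.

Let two_intervals_separable : separable X.
Proof.
pose p (ab : rat * rat) : X := xget point [set x | ratr ab.1 < inc x < ratr ab.2].
exists (range p).
  by apply: (sub_countable (card_image_le _ _)); exact: countableP.
move=> U [x Ux] oU.
have /nbhs_dist[e e0 xeU] : nbhs x U by exact: open_nbhs_nbhs.
have xe1 : inc x - e < inc x by rewrite ltrBlDr ltrDl.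
have xe2 : inc x < inc x + e by rewrite ltrDl.
have [a] := rat_in_itvoo xe1; rewrite in_itv/= => /andP[a1 a2].
have [b] := rat_in_itvoo xe2; rewrite in_itv/= => /andP[b1 b2].
exists (p (a, b)); split; last by exists (a, b).
have /= /andP[h1 h2] : [set x | ratr a < inc x < ratr b] (p (a, b)).
  by apply: (xgetPex point); exists x => /=; rewrite a2 b1.
apply: xeU => /=; rewrite /two_intervals_dist distrC ltr_distl.
by rewrite (lt_trans a1 h1) (lt_trans h2 b2).
Qed.

Let two_intervals_complete : completely_metrizable R X.
Proof.
exists two_intervals_dist; split => //.
- by move=> x y; split=> [/dist_pos//|->].
move=> u cu.
pose v n : R := inc (u n).
have : cvgn v.
  apply/cauchy_cvgP; apply: cauchy_exP.
  move=> e e0; have [N HN] := cu e e0.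
  exists (v N); exists N => //= n /= Nn.
  by rewrite /ball/=; exact: HN.
move=> cv; have cl : closed (two_intervals_set q).
  by apply: closedU; exact: itv_closed.
have lX : two_intervals_set q (limn v).
  apply: (@closed_cvg _ _ \oo _ v _ cl _ _ cv).
  by apply: nearW => n; exact: two_intervals_valP.
exists (SigSub (mem_set lX)); apply/cvg_ballP => e e0.
have /cvg_ballP/(_ _ e0) := cv.
by apply: filterS => n; rewrite ballEmdist.
Qed.

HB.instance Definition _ := @isMetricPolish.Build R two_intervals_display X
  two_intervals_separable two_intervals_complete erefl.

Lemma measurable_two_intervals_set :
  measurable (two_intervals_set q : set (measurableTypeR R)).
Proof. by apply: measurableU; exact: measurable_itv. Qed.

Lemma measurable_two_intervals_image (A : set X) : measurable A ->
  measurable (inc @` A : set (measurableTypeR R)).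
Proof.
pose G := [set A : set X | measurable (inc @` A : set (measurableTypeR R))].
apply: (@smallest_sub _ (sigma_algebra setT) (@open X) G).
  split.
  - by rewrite /G /= image_set0.
  - move=> B GB; rewrite /G/= setTD.
    have -> : inc @` (~` B) = two_intervals_set q `\` inc @` B.
      apply/seteqP; split=> [_ [x nBx <-]|y [yX nBy]].
        split; first exact: two_intervals_valP.
        by move=> [z Bz /two_intervals_val_inj zx]; apply: nBx; rewrite -zx.
      by exists (SigSub (mem_set yX)) => // By; apply: nBy; exists (SigSub (mem_set yX)).
    by apply: measurableD => //; exact: measurable_two_intervals_set.
  - move=> F GF; rewrite /G/= image_bigcup.
    by apply: bigcup_measurable => k _; exact: GF.
move=> U oU; rewrite /G/=.
pose V : set R := \bigcup_(ye in [set ye : X * R | 0 < ye.2 /\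
  [set z | two_intervals_dist ye.1 z < ye.2] `<=` U]) ball (inc ye.1) ye.2.
have -> : inc @` U = two_intervals_set q `&` V.
  apply/seteqP; split=> [_ [x Ux <-]|y [yX [[x e] /= [e0 xeU] xey]]].
    split; first exact: two_intervals_valP.
    have /nbhs_dist[e e0 xeU] : nbhs x U by exact: open_nbhs_nbhs.
    by exists (x, e) => //=; exact: ballxx.
  by exists (SigSub (mem_set yX)) => //; apply: xeU.
apply: measurableI; first exact: measurable_two_intervals_set.
apply: measurable_realfun.open_measurable; apply: bigcup_open => ye [ye0 _].
exact: ball_open.
Qed.

(* Lebesgue measure restricted to the two intervals; the total mass is 1 only
   when 0 <= q <= 1, whence the hypothesis. *)
Definition two_intervals_uniform (q01 : 0 < q < 1) (A : set X) : \bar R :=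
  lebesgue_measure (inc @` A).

Context (q01 : 0 < q < 1).
Local Notation mu := (two_intervals_uniform q01).

Let mu0 : mu set0 = 0%E.
Proof. by rewrite /two_intervals_uniform image_set0 measure0. Qed.

Let mu_ge0 A : (0 <= mu A)%E.
Proof. exact: measure_ge0. Qed.

Let mu_sigma_additive : semi_sigma_additive mu.
Proof.
move=> F mF tF mUF; rewrite /two_intervals_uniform image_bigcup.
apply: measure_semi_sigma_additive.
- by move=> n; exact: measurable_two_intervals_image.
- move=> i j _ _ [_ [[x Fx <-] [y Fy /two_intervals_val_inj yx]]].
  by apply: tF => //; exists x; split=> //; rewrite -yx.
- by rewrite -image_bigcup; exact: measurable_two_intervals_image.
Qed.

HB.instance Definition _ := isMeasure.Build _ X R mu mu0 mu_ge0
  mu_sigma_additive.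

Let mu_setT : mu setT = 1%E.
Proof.
have /andP[q0 q1] := q01.
rewrite /two_intervals_uniform.
have -> : inc @` setT = two_intervals_set q.
  apply/seteqP; split=> [_ [x _ <-]|x xX]; first exact: two_intervals_valP.
  by exists (SigSub (mem_set xX)).
rewrite /two_intervals_set measureU//=; first last.
- apply/seteqP; split=> // x [] /=; rewrite !in_itv/= => /andP[_ xq] /andP[x0 _].
  by have := le_trans x0 xq; rewrite lerNr oppr0 subr_le0 leNgt q1.
rewrite !lebesgue_measure_itv/= !lte_fin ltrN2 ltrBlDr ltrDl q0 subr_gt0 q1.
by rewrite -!EFinB -EFinD; congr EFin; ring.
Qed.

HB.instance Definition _ := Measure_isProbability.Build _ X R mu mu_setT.

End two_intervals.

(* Main.v *)
Require Import Defs.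
From mathcomp Require Import all_boot all_order all_algebra.
From mathcomp Require Import all_classical all_reals all_analysis.

Import Order.TTheory GRing.Theory Num.Theory.
Import numFieldNormedType.Exports.

Local Open Scope classical_set_scope.
Local Open Scope ring_scope.

(** The obstruction is a single test function, the indicator [f] of the right
    interval [[0, 1 - q]]. The two intervals are separated by a gap of length
    [1 - q], so [f] is Lipschitz, and it is constant on every ball of radius
    [r < 1 - q], so all its local Lipschitz constants vanish
    ([lipschitz_const_right_interval]). At a sample point where the estimate
    holds for [f], the empirical mean of [f] therefore equals its integral
    exactly. The integral is [1 - q] ([integral_right_interval]), which is
    irrational, whereas the mean of [n] values in [{0, 1}] is a multiple of
    [1 / n]. Hence the estimate fails at every sample point: an event on which
    it holds is empty and cannot have probability at least [1 - eps > 0].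

    Approximability quantifies over all i.i.d. samples, so refuting it requires
    that at least one exists. [iid_sample_exists] builds it by induction on the
    sample size, from binary products of probability measures.

    For a rate, [r n < 1 - q] and [eps n < 1] hold for large [n]; as either may
    be [0] there, the main argument ([irrational_not_average_case_approximable])
    assumes only these upper bounds. *)

(** The product rule over the full index set suffices: putting the whole space,
    of mass 1, at the remaining indices yields the rule for every subfamily,
    and the singletons give the laws. *)
Lemma iid_of_product_rule {R : realType} {d d' : measure_display}
    {Psi : measurableType d} {T : measurableType d'} {P : probability Psi R}
    {mu : probability T R} {n : nat} (X : 'I_n -> {RV P >-> T}) :
  (forall A : 'I_n -> set T, (forall i, measurable (A i)) ->
     P (\bigcap_i (X i @^-1` A i)) = (\prod_i mu (A i))%E) ->
  iid_with_law mu X.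
Proof.
move=> prodX.
have prodJ (J : {set 'I_n}) (A : 'I_n -> set T) :
    (forall i, i \in J -> measurable (A i)) ->
    P (\bigcap_(i in [set` J]) (X i @^-1` A i)) = (\prod_(i in J) mu (A i))%E.
  move=> mA; pose B i := if i \in J then A i else setT.
  transitivity (P (\bigcap_i (X i @^-1` B i))).
    congr (P _); apply/seteqP; split=> w Aw i /=; rewrite /B.
      by case: ifPn => // iJ _; exact: Aw.
    by move=> iJ; have /= := Aw i Logic.I; rewrite /B iJ.
  rewrite prodX; last by move=> i; rewrite /B; case: ifPn => // /mA.
  rewrite [RHS]big_mkcond/=; apply: eq_bigr => i _; rewrite /B.
  by case: ifPn => // _; rewrite probability_setT.
have lawX i (A : set T) : measurable A -> distribution P (X i) A = mu A.
  move=> mA; have := prodJ [set i]%SET (fun=> A) (fun _ _ => mA).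
  rewrite big_set1 => <-; rewrite /distribution /pushforward; congr (P _).
  apply/seteqP; split=> w Aw; last by apply: Aw; rewrite /= inE.
  by move=> j /=; rewrite inE => /eqP ->.
split=> // J A mA; rewrite prodJ//; apply: eq_bigr => i iJ.
by rewrite -(lawX i)//; exact: mA.
Qed.

Lemma iid_sample_exists {R : realType} {d : measure_display}
    {T : measurableType d} (mu : probability T R) (n : nat) :
  exists (d' : measure_display) (Psi : measurableType d')
    (P : probability Psi R) (X : 'I_n -> {RV P >-> T}), iid_with_law mu X.
Proof.
(* The product rule over all indices is the form that the induction carries. *)
suff [d' [Psi [P [X prodX]]]] : exists (d' : measure_display)
    (Psi : measurableType d') (P : probability Psi R)
    (X : 'I_n -> {RV P >-> T}),
    forall A : 'I_n -> set T, (forall i, measurable (A i)) ->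
      P (\bigcap_i (X i @^-1` A i)) = (\prod_i mu (A i))%E.
  by exists d', Psi, P, X; exact: iid_of_product_rule.
elim: n => [|n [d' [Psi [P [X prodX]]]]].
  (* Any probability space will do for the empty sample; [T] is at hand. *)
  exists d, T, mu, (fun i : 'I_0 => False_rect _ (notF (ltn_ord i))) => A mA.
  rewrite big_ord0 -[RHS](probability_setT mu); congr (mu _).
  by apply/seteqP; split=> // w _ [].
(* The new draw is the coordinate of index 0, and the event cut out by [A] is
   the rectangle of [A ord0] and an event of the shorter sample. *)
pose Y (i : 'I_n.+1) (w : T * Psi) : T :=
  if unlift ord0 i is Some j then X j w.2 else w.1.
have mY i : measurable_fun setT (Y i).
  rewrite /Y; case: unliftP => [j|] _; last exact: measurable_fst.
  exact: (measurableT_comp (measurable_funPT (X j)) measurable_snd).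
exists _, (T * Psi)%type, (mu \x P)%E, (fun i => mfun_Sub (mem_set (mY i))).
move=> A mA; rewrite big_ord_recl -prodX//.
rewrite -product_measure1E//; last first.
  apply: fin_bigcap_measurable => // i _.
  by rewrite -[X in measurable X]setTI; exact: measurable_funPT.
congr product_measure1; apply/seteqP; split=> [w Yw|w [Aw1 Aw2] i _] /=.
  split=> [|j _] /=.
    by have /= := Yw ord0 Logic.I; rewrite /Y unlift_none.
  by have /= := Yw (lift ord0 j) Logic.I; rewrite /Y liftK.
rewrite /Y; case: unliftP => [j|] -> //.
exact: Aw2.
Qed.

(** The infimum that defines the constant is attained at 0. This includes the
    case of the empty set, where every nonnegative [L] is a bound. *)
Lemma lipschitz_const_eq0 {R : realType} {T : metricType R} (A : set T)
    (f : T -> R) :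
  (forall y z, A y -> A z -> f y = f z) -> lipschitz_const A f = 0.
Proof.
move=> f_const.
have f0 : [set L | lipschitz_bound A f L] 0.
  by split=> // y z Ay Az; rewrite (f_const y z)// subrr normr0 mul0r.
have lb0 : lbound [set L | lipschitz_bound A f L] 0 by move=> L [].
apply/eqP; rewrite eq_le; apply/andP; split.
  by apply: ge_inf => //; exists 0.
by apply: lb_le_inf => //; exists 0.
Qed.

Section right_interval.
Context {R : realType} {q : R} (q01 : 0 < q < 1).
Local Notation inc := (@two_intervals_val R q).
Local Notation mu := (two_intervals_uniform q01).

Definition right_interval : set (two_intervals q) := [set x | 0 <= inc x].

(** A point of the space that is not in the right interval is in the left one,
    hence at most [-(1 - q)]: this is the gap on which everything rests. *)
Lemma le_mdist_right_interval (x y : two_intervals q) :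
  right_interval x -> ~ right_interval y -> 1 - q <= mdist x y.
Proof.
move=> /= x0 /negP; rewrite -ltNge => y0.
have yq : inc y <= - (1 - q).
  have [|] := two_intervals_valP y; rewrite /= in_itv/= => /andP[] //.
  by rewrite leNgt y0.
apply: le_trans (ler_norm _).
by rewrite -[leLHS]add0r lerD// lerNr.
Qed.

Lemma right_interval_close (r : R) (x y : two_intervals q) :
  r < 1 - q -> mdist x y <= r -> right_interval x <-> right_interval y.
Proof.
move=> rq xyr; have xyq := le_lt_trans xyr rq.
split=> [xr|yr]; apply: contrapT => /le_mdist_right_interval.
- by move=> /(_ x xr); rewrite leNgt xyq.
- by move=> /(_ y yr); rewrite metric_sym leNgt xyq.
Qed.

(** The gap makes the right interval open in the space. *)
Lemma measurable_right_interval : measurable right_interval.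
Proof.
have q1 : 0 < 1 - q by have /andP[_] := q01; rewrite subr_gt0.
apply: sub_sigma_algebra; rewrite openE => x xr.
apply/nbhs_ballP; exists (1 - q) => //= y; rewrite ballEmdist => xy.
apply: contrapT => yr.
by have := le_mdist_right_interval _ _ xr yr; rewrite leNgt xy.
Qed.

Lemma uniform_right_interval : mu right_interval = (1 - q)%:E.
Proof.
have [q0 q1] := andP q01.
rewrite /two_intervals_uniform (_ : inc @` _ = `[0, 1 - q]%classic).
  by rewrite lebesgue_measure_itv/= lte_fin subr_gt0 q1 sube0.
apply/seteqP; split=> [_ [x xr <-]|x x01].
  have [|//] := two_intervals_valP x; rewrite /= in_itv/= => /andP[_ xq].
  by have := le_trans xr xq; rewrite oppr_ge0 leNgt subr_gt0 q1.
have xX : x \in two_intervals_set q by apply/mem_set; right.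
by exists (SigSub xX) => //; move: x01; rewrite /= in_itv/= => /andP[].
Qed.

Lemma integral_right_interval :
  (\int[mu]_x (\1_right_interval x)%:E = (1 - q)%:E)%E.
Proof.
rewrite integral_indic//; last exact: measurable_right_interval.
rewrite setIT; exact: uniform_right_interval.
Qed.

(** The indicator jumps by 1 only between points at least [1 - q] apart. *)
Lemma lipschitz_right_interval : is_lipschitz (\1_right_interval : _ -> R).
Proof.
have q1 : 0 < 1 - q by have /andP[_] := q01; rewrite subr_gt0.
exists (1 - q)^-1; split=> [|y z _ _]; first by rewrite invr_ge0 ltW.
rewrite mulrC ler_pdivlMr// !indicE.
have [/set_mem yr|/negP yr] := boolP (y \in right_interval);
  have [/set_mem zr|/negP zr] := boolP (z \in right_interval).
- by rewrite subrr normr0 mul0r mdist_ge0.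
- rewrite subr0 normr1 mul1r; apply: le_mdist_right_interval => //.
  by move=> /mem_set.
- rewrite sub0r normrN normr1 mul1r metric_sym.
  by apply: le_mdist_right_interval => // /mem_set.
- by rewrite subrr normr0 mul0r mdist_ge0.
Qed.

Lemma lipschitz_const_right_interval (r : R) (x : two_intervals q) :
  r < 1 - q -> lipschitz_const (mclosed_ball x r) \1_right_interval = 0 :> R.
Proof.
move=> rq; apply: lipschitz_const_eq0 => y z xy xz; rewrite !indicE.
congr (nat_of_bool _)%:R; apply/idP/idP => /set_mem h; apply/mem_set.
- by apply/(right_interval_close _ _ _ rq xz)/(right_interval_close _ _ _ rq xy).
- by apply/(right_interval_close _ _ _ rq xy)/(right_interval_close _ _ _ rq xz).
Qed.

(** A single point of the event is enough for a contradiction: there the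
    estimate for the indicator reads [1 - q = k / n], with [k] the number of
    sample points in the right interval. *)
Lemma irrational_not_average_case_approximable (n : nat) (eps r : R) :
  irrational q -> (0 < n)%N -> r < 1 - q -> eps < 1 ->
  ~ average_case_approximable mu n eps r.
Proof.
move=> q_irr n0 rq eps1 approx.
have [d' [Psi [P [X iidX]]]] := iid_sample_exists mu n.
have [E [_ PE boundE]] := approx d' Psi P X iidX.
have [w Ew] : E !=set0.
  apply/set0P/eqP => E0; move: PE.
  by rewrite E0 measure0 lee_fin leNgt subr_gt0 eps1.
have := boundE w Ew _ lipschitz_right_interval.
rewrite integral_right_interval.
rewrite [in leRHS]big1 => [|i _]; last exact: lipschitz_const_right_interval.
rewrite mul0r mulr0 -EFinB lee_fin normr_le0 subr_eq0 => /eqP qE.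
apply: q_irr.
exists (1 - (\sum_(i < n) (X i w \in right_interval : nat))%N%:R / n%:R) => //.
rewrite rmorphB rmorph1 fmorph_div/= !ratr_nat.
apply/eqP; rewrite subr_eq addrC -subr_eq; apply/eqP; rewrite qE natr_sum.
by congr (_ / _); apply: eq_bigr => i _; rewrite indicE.
Qed.

End right_interval.

Theorem proposition3p9 (R : realType) (q : R) (q01 : 0 < q < 1)
    (q_irrational : irrational q) :
  (forall (n : nat) (eps r : R),
     (0 < n)%N -> 0 < r < 1 - q -> 0 < eps < 1 ->
     ~ average_case_approximable (two_intervals_uniform q01) n eps r) /\
  (forall eps r : nat -> R,
     vanishing_rate eps -> vanishing_rate r ->
     ~ asymptotically_average_case_approximable
         (two_intervals_uniform q01) eps r).
Proof.
split=> [n eps r n0 /andP[_ rq] /andP[_ eps1]|eps r [_ eps0] [_ r0] approx].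
  exact: irrational_not_average_case_approximable.
have q1 : 0 < 1 - q by have /andP[_] := q01; rewrite subr_gt0.
have epsn : \forall n \near \oo, eps n < 1.
  by apply: (cvgr_lt _ eps0); exact: ltr01.
have rn : \forall n \near \oo, r n < 1 - q.
  by apply: (cvgr_lt _ r0).
have [n [n0 [[epsn1 rnq] approxn]]] : exists n, (0 < n)%N /\
    (eps n < 1 /\ r n < 1 - q) /\
    average_case_approximable (two_intervals_uniform q01) n (eps n) (r n).
  near \oo => n; exists n; split; first by near: n; exact: nbhs_infty_gt.
  by split; [split|]; near: n.
exact: irrational_not_average_case_approximable q_irrational n0 rnq epsn1 approxn.
Unshelve. all: by end_near.
Qed.
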